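(* Let $X$ be a Tychonoff space and let $\aleph_\alpha\geq\aleph_1$ be a cardinal. Then $$w(C_{\aleph_\alpha}(X))=cc_{\aleph_\alpha}(X)\,d(C_{\aleph_\alpha}(X))=cc_{\aleph_\alpha}(X)\,L(C_{\aleph_\alpha}(X))=cc_{\aleph_\alpha}(X)\,s(C_{\aleph_\alpha}(X))=cc_{\aleph_\alpha}(X)\,c(C_{\aleph_\alpha}(X)),$$ where juxtaposition denotes cardinal multiplication.
   Context: Tychonoff means completely regular and Hausdorff. $C(X)$ is the set of all real-valued continuous functions on $X$. For an infinite cardinal $\aleph_\alpha$, $\mathcal{A}_{\aleph_\alpha}=\{A\subseteq X: |A|<\aleph_\alpha\}$. For $f\in C(X)$, $A\in\mathcal{A}_{\aleph_\alpha}$ and real $\epsilon>0$ put $B(f,A,\epsilon)=\{g\in C(X): \sup_{x\in A}|f(x)-g(x)|<\epsilon\}$ (equal to $C(X)$ when $A=\emptyset$). The sets $B(f,A,\epsilon)$ form a base of a topology on $C(X)$; $C_{\aleph_\alpha}(X)$ denotes $C(X)$ with this topology. A family $\mathcal{B}\subseteq\mathcal{A}_{\aleph_\alpha}$ is an $\aleph_\alpha$-closed family in $X$ if for every $A\in\mathcal{A}_{\aleph_\alpha}$ there is $B\in\mathcal{B}$ with $A\subseteq\overline{B}$, and $cc_{\aleph_\alpha}(X)=\aleph_0+\min\{|\mathcal{B}|: \mathcal{B}\text{ is an }\aleph_\alpha\text{-closed family in }X\}$. For a space $Y$: weight $w(Y)=\aleph_0+\min\{|\mathcal{B}|:\mathcal{B}\text{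 is an open base of }Y\}$; density $d(Y)=\aleph_0+\min\{|D|: D\text{ dense in }Y\}$; Lindelöf number $L(Y)=\aleph_0+\min\{\kappa:\text{ each open cover of }Y\text{ has a subcover of cardinality}\leq\kappa\}$; spread $s(Y)=\aleph_0+\sup\{|D|: D\subseteq Y\text{ is discrete in the subspace topology}\}$; Souslin number $c(Y)=\aleph_0+\sup\{|\mathcal{U}|:\mathcal{U}\text{ is a family of pairwise disjoint non-empty open sets in }Y\}$. *)

(* Defs.v *)
From HB Require Import structures.
From mathcomp Require Import all_boot all_order all_algebra.
From mathcomp Require Import all_classical all_reals all_analysis.

Set Implicit Arguments.
Unset Strict Implicit.
Unset Printing Implicit Defensive.

Import Order.TTheory GRing.Theory Num.Theory.
Import numFieldNormedType.Exports.

Local Open Scope classical_set_scope.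
Local Open Scope ring_scope.

(** A cardinal number is an equipotence class of types, so that two sets have
    the same cardinality exactly when their cardinals are Leibniz-equal
    ([Card_eqP]). *)
Record cardinal := Cardinal {
  card_class :> Type -> Prop;
  card_classP : exists T : Type,
    card_class = (fun U : Type => is_true ([set: U] #= [set: T])%card) }.

Declare Scope cardinal_scope.
Delimit Scope cardinal_scope with card_num.
Bind Scope cardinal_scope with cardinal.
Local Open Scope cardinal_scope.

Definition CardT (T : Type) : cardinal :=
  @Cardinal (fun U : Type => is_true ([set: U] #= [set: T])%card)
    (ex_intro _ T erefl).

(** [{x | A x}] and not [set_type A], and below [cardinal -> Prop] and not
    [set cardinal]: either library constant would put the universe of [set]
    in conflict with that of [cardinal]. *)
Definition Card (T : Type) (A : set T) : cardinal := CardT {x | A x}.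

Definition card_repr (c : cardinal) : Type := projT1 (cid (card_classP c)).

Lemma card_reprK (c : cardinal) : CardT (card_repr c) = c.
Proof.
rewrite /card_repr; case: c => P hP /=; case: cid => T /= eP.
by subst P; congr Cardinal; exact: Prop_irrelevance.
Qed.

Lemma CardT_eqP (T U : Type) :
  CardT T = CardT U <-> ([set: T] #= [set: U])%card.
Proof.
split=> [e|TU].
  have : CardT T T by exact: card_eqxx.
  by rewrite e.
have e : card_class (CardT T) = card_class (CardT U).
  apply: funext => V /=; apply: propext.
  by split=> VT; apply: (card_eq_trans VT) => //; rewrite card_eq_sym.
case: (CardT T) (CardT U) e => P hP [Q hQ] /= e; subst Q.
by congr Cardinal; exact: Prop_irrelevance.
Qed.

Lemma CardT_sig (T : Type) (A : set T) : ([set: {x | A x}] #= A)%card.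
Proof.
have e : [set sval x | x in [set: {x | A x}]] = A.
  by apply/seteqP; split=> [_ [x _ <-]|x Ax]; [exact: svalP|exists (exist _ x Ax)].
suff : ([set sval x | x in [set: {x | A x}]] #= [set: {x | A x}])%card.
  by rewrite e card_eq_sym.
apply: inj_card_eq => -[x Ax] [y Ay] _ _ /= xy.
by subst y; congr exist; exact: Prop_irrelevance.
Qed.

Lemma Card_eqP (T U : Type) (A : set T) (B : set U) :
  Card A = Card B <-> (A #= B)%card.
Proof.
apply: (iff_trans (CardT_eqP _ _)).
by rewrite (card_eql (CardT_sig A)) (card_eqr (CardT_sig B)).
Qed.

Definition card_num_le (c d : cardinal) : Prop :=
  ([set: card_repr c] #<= [set: card_repr d])%card.

Definition card_num_lt (c d : cardinal) : Prop := card_num_le c d /\ c <> d.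

Definition card_num_add (c d : cardinal) : cardinal :=
  CardT (card_repr c + card_repr d)%type.

Definition card_num_mul (c d : cardinal) : cardinal :=
  CardT (card_repr c * card_repr d)%type.

Notation "c <= d" := (card_num_le c d) : cardinal_scope.
Notation "c < d" := (card_num_lt c d) : cardinal_scope.
Notation "c + d" := (card_num_add c d) : cardinal_scope.
Notation "c * d" := (card_num_mul c d) : cardinal_scope.

Lemma Card_leP (T U : Type) (A : set T) (B : set U) :
  Card A <= Card B <-> (A #<= B)%card.
Proof.
have eA : ([set: card_repr (Card A)] #= A)%card.
  by apply: card_eq_trans (CardT_sig A); apply/CardT_eqP; exact: card_reprK.
have eB : ([set: card_repr (Card B)] #= B)%card.
  by apply: card_eq_trans (CardT_sig B); apply/CardT_eqP; exact: card_reprK.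
by rewrite /card_num_le (card_le_eql eA) (card_le_eqr eB).
Qed.

Lemma card_family_min (I : Type) (X : I -> Type) : inhabited I ->
  exists i, forall j, ([set: X i] #<= [set: X j])%card.
Proof.
move=> [i0].
pose inj := [set G : set (forall i, X i) |
  forall g h i, G g -> G h -> g i = h i -> g = h].
have [|G [injG maxG]] := @Zorn_bigcup _ inj.
  move=> F Finj totF g h i [A FA Ag] [B FB Bh].
  by have [AB|BA] := totF A B FA FB;
    [apply: (Finj B)=> //; exact: AB|apply: (Finj A)=> //; exact: BA].
have [i Gi] : exists i, forall x : X i, exists2 g, G g & g i = x.
  apply: contrapT => /forallNP nG.
  have {}nG i : {x : X i | forall g, G g -> g i <> x}.
    apply: cid; have /existsNP[x nx] := nG i.
    by exists x => g Gg gx; apply: nx; exists g.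
  pose h i := sval (nG i).
  have nGh : ~ G h by move=> Gh; exact: (svalP (nG i0) h Gh erefl).
  have GGh : G `<` G `|` [set h].
    by split=> [x Gx|GhG]; [left|apply: nGh; apply: GhG; right].
  apply: (maxG _ GGh) => g g' i [Gg|->] [Gg'|->]; [exact: injG| | |by []].
    by move/(svalP (nG i) g Gg).
  by move/esym/(svalP (nG i) g' Gg').
exists i => j; pose f x := s2val (cid2 (Gi x)).
have fG x : G (f x) by rewrite /f; case: cid2.
have fi x : f x i = x by rewrite /f; case: cid2.
have finj : {in [set: X i] &, injective (fun x => f x j)}.
  move=> x y _ _ fxy; rewrite -(fi x) -(fi y).
  by rewrite (injG _ _ _ (fG x) (fG y) fxy).
apply: (card_le_trans (B := [set f x j | x in [set: X i]])); last exact: card_leT.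
have := inj_card_eq finj.
by move=> /card_eqPle[].
Qed.

Lemma card_num_le_total (c d : cardinal) : c <= d \/ d <= c.
Proof.
have [b bP] := @card_family_min bool (fun b => card_repr (if b then c else d)) (inhabits true).
by case: b bP => bP; [left; exact: (bP false)|right; exact: (bP true)].
Qed.

Definition card_lower (P : cardinal -> Prop) (c : cardinal) : Prop :=
  P c /\ forall d, P d -> c <= d.

(** The least element of a nonempty class of cardinals ([card_minP]); the value
    for an empty class is junk. *)
Definition card_min (P : cardinal -> Prop) : cardinal :=
  if pselect (exists c, card_lower P c) is left e then projT1 (cid e)
  else CardT void.

Lemma card_minP (P : cardinal -> Prop) :
  (exists c, P c) -> card_lower P (card_min P).
Proof.
move=> [c Pc]; rewrite /card_min; case: pselect => [e|]; first by case: cid.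
case.
pose I := {A : set (card_repr c) | P (Card A)}.
have cT : Card [set: card_repr c] = c.
  by rewrite -[RHS]card_reprK; apply/CardT_eqP; exact: CardT_sig.
have PT : P (Card [set: card_repr c]) by rewrite cT.
have [[A PA] Amin] := @card_family_min I (fun i => {x | sval i x}) (inhabits (exist _ _ PT)).
exists (Card A); split=> // d Pd.
have [cd|dc] := card_num_le_total c d.
  have := Amin (exist _ _ PT).
  rewrite (card_le_eql (CardT_sig A)) (card_le_eqr (CardT_sig _)) => /Card_leP.
  by rewrite cT => Ac; apply: card_le_trans cd.
have [B dB] : exists B : set (card_repr c), Card B = d.
  move/card_leP: dc => [f].
  exists (range (fun x => set_val (f x))); rewrite -[RHS]card_reprK; apply/CardT_eqP.
  apply: (card_eq_trans (CardT_sig _)).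
  apply: card_eq_trans (card_setT [set: card_repr d]).
  by apply: inj_card_eq => x y xT yT /val_inj; apply: inj.
rewrite -dB in Pd *.
have := Amin (exist _ _ Pd).
by rewrite (card_le_eql (CardT_sig A)) (card_le_eqr (CardT_sig _)) => /Card_leP.
Qed.

(** The supremum is the least upper bound: it need not be attained. *)
Definition card_sup (P : cardinal -> Prop) : cardinal :=
  card_min (fun c => forall d, P d -> d <= c).

Definition Cards (T : Type) (F : set (set T)) : cardinal -> Prop :=
  fun c => exists2 A, F A & c = Card A.

Definition aleph0 : cardinal := CardT nat.

Definition aleph1 : cardinal := card_min (fun c => aleph0 < c).

Section cardinal_functions.
Variable Y : topologicalType.

Definition weight : cardinal :=
  aleph0 + card_min (Cards [set B : set (set Y) | basis B]).

Definition density : cardinal :=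
  aleph0 + card_min (Cards [set D : set Y | dense D]).

Definition open_cover (U : set (set Y)) : Prop :=
  U `<=` open /\ \bigcup_(V in U) V = [set: Y].

Definition lindelof_number : cardinal :=
  aleph0 + card_min (fun k => forall U : set (set Y), open_cover U ->
    exists V, [/\ V `<=` U, open_cover V & Card V <= k]).

Definition discrete_subset (D : set Y) : Prop :=
  forall V : set (set_type D), open V.

Definition spread : cardinal :=
  aleph0 + card_sup (Cards [set D : set Y | discrete_subset D]).

Definition cellular_family (U : set (set Y)) : Prop :=
  [/\ U `<=` open, forall V, U V -> V !=set0 & trivIset U id].

Definition souslin_number : cardinal :=
  aleph0 + card_sup (Cards [set U : set (set Y) | cellular_family U]).

End cardinal_functions.

Definition tychonoff_space (X : topologicalType) : Prop :=
  completely_regular_space X /\ hausdorff_space X.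

Definition small_subsets (X : Type) (k : cardinal) : set (set X) :=
  [set A | Card A < k].

(** The supremum is taken in the extended reals: it is [+oo] when [f - g] is
    unbounded on [A], and [-oo] when [A] is empty, so that
    [uball f set0 e = setT]. *)
Definition uball (R : realType) (X : topologicalType) (f : continuousType X R)
    (A : set X) (e : R) : set (continuousType X R) :=
  [set g | (ereal_sup [set `|f x - g x|%:E | x in A] < e%:E)%E].

Definition uballs (R : realType) (X : topologicalType) (k : cardinal) :
    set (set (continuousType X R)) :=
  [set U | exists f A e, [/\ small_subsets k A, (0 < e)%R & U = uball f A e]].

(** C_k(X): a copy of the type of continuous functions, so that the topology
    can depend on [k]. The topology is the one generated by [uballs]. For
    infinite [k] the union of two sets in [small_subsets k] is again in
    [small_subsets k], and [uballs] is then a base and not only a subbase. *)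
Definition Ck (R : realType) (X : topologicalType) (k : cardinal) : Type :=
  continuousType X R.

HB.instance Definition _ (R : realType) (X : topologicalType) (k : cardinal) :=
  Choice.copy (Ck R X k) (continuousType X R).

HB.instance Definition _ (R : realType) (X : topologicalType) (k : cardinal) :=
  @isSubBaseTopological.Build (Ck R X k)
    (set (continuousType X R)) (@uballs R X k) id.

Definition closed_family (X : topologicalType) (k : cardinal)
    (B : set (set X)) : Prop :=
  B `<=` small_subsets k /\
  forall A, small_subsets k A -> exists2 D, B D & A `<=` closure D.

Definition cc (X : topologicalType) (k : cardinal) : cardinal :=
  aleph0 + card_min (Cards [set B : set (set X) | closed_family k B]).

(* Main.v *)
(** Write [Y] for [Ck R X k]. It is a topological group in which the balls
    [uball 0 A (1 / n)], with [A] in a closed family, form a base at [0], so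
    that [weight Y <= cc X k * density Y]. Complete regularity gives
    [cc X k <= weight Y]: the sets [A] of the balls [uball 1 A e] inside the
    members of a base at [1] form a closed family. If [N] bounds the number of
    translates of a basic neighbourhood needed to cover [Y], then the centres
    of these translates, for all neighbourhoods in the above base, are dense,
    and [density Y <= cc X k * N]. One can take [N] to be the Lindelof number,
    or the Souslin number (the centres of a maximal disjoint family of balls
    of half the radius). The inequalities [c <= s <= w], [L <= w] and [d <= w]
    hold in every space, and [c * c = c] for infinite cardinals turns the
    estimates into equalities. *)

From HB Require Import structures.
Require Import Defs.
From mathcomp Require Import all_boot all_order all_algebra.
From mathcomp Require Import all_classical all_reals all_analysis.

Set Implicit Arguments.
Unset Strict Implicit.
Unset Printing Implicit Defensive.

Import Order.TTheory GRing.Theory Num.Theory.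
Import numFieldNormedType.Exports.

Local Open Scope classical_set_scope.
Local Open Scope ring_scope.
Local Open Scope cardinal_scope.

(** ** Arithmetic of infinite cardinals *)

Lemma card_le_setTP (T U : Type) :
  ([set: T] #<= [set: U])%card <-> exists f : T -> U, injective f.
Proof.
split=> [/card_leP[f]|[f f_inj]].
  exists (fun x => set_val (f (SigSub (mem_set (I : [set: T] x))))) => x y.
  by move=> /val_inj /inj; rewrite !inE => /(_ I I) /(congr1 val).
apply: (card_le_trans (B := [set f x | x in [set: T]])); last exact: card_leT.
have : {in [set: T] &, injective f} by move=> x y _ _; exact: f_inj.
by move=> /inj_card_eq /card_eqPle[].
Qed.

Lemma card_reprE (T : Type) : ([set: card_repr (CardT T)] #= [set: T])%card.
Proof. by apply/CardT_eqP; exact: card_reprK. Qed.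

Lemma CardT_leP (T U : Type) :
  CardT T <= CardT U <-> exists f : T -> U, injective f.
Proof.
rewrite /card_num_le (card_le_eql (card_reprE T)) (card_le_eqr (card_reprE U)).
exact: card_le_setTP.
Qed.

Lemma card_num_le_refl (c : cardinal) : c <= c.
Proof. exact: card_lexx. Qed.

Lemma card_num_le_trans (d c e : cardinal) : c <= d -> d <= e -> c <= e.
Proof. exact: card_le_trans. Qed.

Lemma card_num_le_anti (c d : cardinal) : c <= d -> d <= c -> c = d.
Proof.
move=> cd dc; rewrite -(card_reprK c) -(card_reprK d); apply/CardT_eqP.
exact/card_eqPle.
Qed.

Lemma card_num_ltP (c d : cardinal) : c < d <-> ~ d <= c.
Proof.
split=> [[cd nE] dc|ndc]; first by apply: nE; exact: card_num_le_anti.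
split; first by have [|/ndc] := card_num_le_total c d.
by move=> cd; apply: ndc; rewrite cd; exact: card_num_le_refl.
Qed.

(** Used as an eliminator: it replaces a cardinal by [CardT] of a type, so that inequalities between
    cardinals become injections between types. *)
Lemma card_ind (P : cardinal -> Prop) :
  (forall T, P (CardT T)) -> forall c, P c.
Proof. by move=> PT c; rewrite -(card_reprK c). Qed.

Lemma CardT_mul (T U : Type) : CardT (T * U) = CardT T * CardT U.
Proof.
have /CardT_eqP/card_eqPle[/card_le_setTP[f fi] /card_le_setTP[f' fi']] :=
  card_reprK (CardT T).
have /CardT_eqP/card_eqPle[/card_le_setTP[g gi] /card_le_setTP[g' gi']] :=
  card_reprK (CardT U).
apply: card_num_le_anti; apply/CardT_leP.
  by exists (fun p => (f' p.1, g' p.2)) => -[? ?] [? ?] [] /= /fi' -> /gi' ->.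
by exists (fun p => (f p.1, g p.2)) => -[? ?] [? ?] [] /= /fi -> /gi ->.
Qed.

Lemma CardT_add (T U : Type) : CardT (T + U) = CardT T + CardT U.
Proof.
have /CardT_eqP/card_eqPle[/card_le_setTP[f fi] /card_le_setTP[f' fi']] :=
  card_reprK (CardT T).
have /CardT_eqP/card_eqPle[/card_le_setTP[g gi] /card_le_setTP[g' gi']] :=
  card_reprK (CardT U).
apply: card_num_le_anti; apply/CardT_leP.
  exists (fun p => match p with inl x => inl (f' x) | inr x => inr (g' x) end).
  by move=> [x|x] [y|y] [] // => [/fi'|/gi'] ->.
exists (fun p => match p with inl x => inl (f x) | inr x => inr (g x) end).
by move=> [x|x] [y|y] [] // => [/fi|/gi] ->.
Qed.

Lemma card_num_le_mul (a b c d : cardinal) : a <= c -> b <= d -> a * b <= c * d.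
Proof.
elim/card_ind: a => a; elim/card_ind: b => b; elim/card_ind: c => c.
elim/card_ind: d => d /CardT_leP[f fi] /CardT_leP[g gi].
rewrite -!CardT_mul; apply/CardT_leP.
by exists (fun p => (f p.1, g p.2)) => -[? ?] [? ?] [] /= /fi -> /gi ->.
Qed.

Lemma card_num_le_add (a b c d : cardinal) : a <= c -> b <= d -> a + b <= c + d.
Proof.
elim/card_ind: a => a; elim/card_ind: b => b; elim/card_ind: c => c.
elim/card_ind: d => d /CardT_leP[f fi] /CardT_leP[g gi].
rewrite -!CardT_add; apply/CardT_leP.
exists (fun p => match p with inl x => inl (f x) | inr x => inr (g x) end).
by move=> [x|x] [y|y] [] // => [/fi|/gi] ->.
Qed.

Lemma card_num_le_addl (c d : cardinal) : c <= c + d.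
Proof.
elim/card_ind: c => c; elim/card_ind: d => d; rewrite -CardT_add.
by apply/CardT_leP; exists inl => x y [].
Qed.

Lemma card_num_le_addr (c d : cardinal) : d <= c + d.
Proof.
elim/card_ind: c => c; elim/card_ind: d => d; rewrite -CardT_add.
by apply/CardT_leP; exists inr => x y [].
Qed.

(** Choosing a [P]-related value for each point of [A] gives a map, and the second hypothesis makes
    it injective. With a relation, no map on the subtype of [A] has to be written down. *)
Lemma Card_le_rel (T V : Type) (A : set T) (P : T -> V -> Prop) :
  (forall x, A x -> exists v, P x v) ->
  (forall x y v, A x -> A y -> P x v -> P y v -> x = y) ->
  Card A <= CardT V.
Proof.
move=> Pex Puniq; apply/CardT_leP.
have {}Pex (x : {x | A x}) : exists v, P (sval x) v by apply: Pex; exact: svalP.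
have [f Pf] := choice Pex; exists f => -[x Ax] [y Ay] fxy.
have := Pf (exist _ x Ax); rewrite fxy /= => Pxv.
have xy : x = y by exact: Puniq Pxv (Pf (exist _ y Ay)).
by subst y; congr exist; exact: Prop_irrelevance.
Qed.

Lemma Card_le_inj (T U : Type) (f : T -> U) (A : set T) (B : set U) :
  (forall x, A x -> B (f x)) ->
  (forall x y, A x -> A y -> f x = f y -> x = y) -> Card A <= Card B.
Proof.
move=> AB fi; apply: (@Card_le_rel _ _ _ (fun x v => f x = sval v)).
  by move=> x Ax; exists (exist _ (f x) (AB x Ax)).
by move=> x y v Ax Ay fx fy; apply: fi => //; rewrite fx fy.
Qed.

(** The injection between the subtypes is extended to all of [T] by the identity outside [A], which
    needs no default value. *)
Lemma Card_le_injP (T : Type) (A B : set T) : Card A <= Card B ->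
  exists f : T -> T, (forall x, A x -> B (f x)) /\
    (forall x y, A x -> A y -> f x = f y -> x = y).
Proof.
move=> /CardT_leP[f fi].
pose g x := if pselect (A x) is left Ax then sval (f (exist _ x Ax)) else x.
exists g; split=> [x Ax|x y Ax Ay]; rewrite /g.
  by case: pselect => // Ax'; exact: svalP.
case: pselect => // Ax'; case: pselect => // Ay' fxy.
suff /fi[] : f (exist _ x Ax') = f (exist _ y Ay') by [].
by apply: eq_sig_hprop fxy => z; exact: Prop_irrelevance.
Qed.

(** Good relations are the graphs of injections [A * A -> A], where [A] is
    recovered from the graph as the set of points with a diagonal image. A
    maximal one has [A] equipotent to [T]: otherwise its complement contains
    a copy of [A], on which the three missing quadrants can be mapped. *)
Section square.
Variable T : Type.

Let field (G : set (T * T * T)) := [set x | exists z, G (x, x, z)].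

Let good (G : set (T * T * T)) := [/\
  (forall x y z, G (x, y, z) -> [/\ field G x, field G y & field G z]),
  (forall x y, field G x -> field G y -> exists z, G (x, y, z)),
  (forall p z z', G (p, z) -> G (p, z') -> z = z') &
  (forall p q z, G (p, z) -> G (q, z) -> p = q)].

Let fieldS G H : G `<=` H -> field G `<=` field H.
Proof. by move=> GH x [z Gz]; exists z; exact: GH. Qed.

(** Each condition in [good] has at most two triples as premises, and two triples of the union lie
    in a common member of the chain. *)
Let good_chain (C : set (set (T * T * T))) : C `<=` good ->
  total_on C subset -> good (\bigcup_(G in C) G).
Proof.
move=> Cgood Ctot.
have joint G H : C G -> C H -> exists K, [/\ C K, G `<=` K & H `<=` K].
  move=> CG CH.
  by have [GH|HG] := Ctot _ _ CG CH; [exists H; split|exists G; split].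
have CS G : C G -> G `<=` \bigcup_(G in C) G by move=> CG x Gx; exists G.
split.
- move=> x y z [G CG Gxyz].
  have [/(_ _ _ _ Gxyz)[Gx Gy Gz] _ _ _] := Cgood _ CG.
  by split; exact: (fieldS (CS _ CG)).
- move=> x y [u [G CG Gx]] [v [H CH Hy]].
  have [K [CK GK HK]] := joint _ _ CG CH.
  have [_ Ktot _ _] := Cgood _ CK.
  have [||z Kz] := Ktot x y; first by exists u; exact: GK.
    by exists v; exact: HK.
  by exists z, K.
- move=> p z z' [G CG Gx] [H CH Hy]; have [K [CK GK HK]] := joint _ _ CG CH.
  have [_ _ Kfun _] := Cgood _ CK.
  by apply: Kfun (GK _ Gx) (HK _ Hy).
- move=> p q z [G CG Gx] [H CH Hy]; have [K [CK GK HK]] := joint _ _ CG CH.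
  have [_ _ _ Kinj] := Cgood _ CK.
  by apply: Kinj (GK _ Gx) (HK _ Hy).
Qed.

(** The pairing of natural numbers, carried along [a], is the seed of the maximal relation. It puts
    every [a i] in the field, where these points later serve as tags. *)
Let good_nat (a : nat -> T) : injective a ->
  good [set ((a p.1, a p.2), a (pickle p)) | p in [set: nat * nat]].
Proof.
move=> a_inj; set G0 := (X in good X).
have fG0 i : field G0 (a i) by exists (a (pickle (i, i))); exists (i, i).
split.
- by move=> x y z [[i j] _ [<- <- <-]].
- move=> x y [_ [[i i'] _ [<- _ _]]] [_ [[j j'] _ [<- _ _]]].
  by exists (a (pickle (i, j))); exists (i, j).
- by move=> p z z' [[i j] _ [<- <-]] [[i' j'] _ [/a_inj-> /a_inj-> <-]].
- move=> p q z [[i j] _ [<- <-]] [[i' j'] _ [<- /a_inj]].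
  by move=> /(pcan_inj pickleK) [-> ->].
Qed.

Lemma CardT_square_infinite (a : nat -> T) : injective a ->
  CardT (T * T) <= CardT T.
Proof.
move=> a_inj.
set G0 := [set ((a p.1, a p.2), a (pickle p)) | p in [set: nat * nat]].
have [K [G0K goodK maxK]] : exists K, [/\ G0 `<=` K, good K &
    forall H, K `<=` H -> good H -> H `<=` K].
  (* The seed [G0] is joined to [G] instead of being required inside it, because the empty chain
     also needs its union to be admissible. Adding [G0] itself to the chain then reduces the claim
     to [good_chain]. *)
  have [|G [goodG maxG]] := @Zorn_bigcup _ [set G | good (G0 `|` G)].
    move=> F Fgood Ftot /=.
    have -> : G0 `|` \bigcup_(H in F) H =
              \bigcup_(H in [set G0] `|` [set G0 `|` H | H in F]) H.
      apply/seteqP.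
      split=> [t [G0t|[H FH Ht]]|t [_ [-> G0t|[H FH <-] [G0t|Ht]]]].
      - by exists G0 => //; left.
      - by exists (G0 `|` H); [right; exists H|right].
      - by left.
      - by left.
      - by right; exists H.
    apply: good_chain => [_ [->|[H FH <-]]|].
    - exact: good_nat.
    - exact: Fgood.
    - move=> _ _ [->|[H FH <-]] [->|[K FK <-]].
      by left.
      by left; left.
      by right; left.
      by have [HK|KH] := Ftot _ _ FH FK; [left|right]; exact: setUS.
  exists (G0 `|` G); split=> // H KH goodH t Ht.
  apply: contrapT => nKt; apply: (maxG H).
    split; last by move=> /(_ _ Ht) Gt; apply: nKt; right.
    by apply: subset_trans KH => u; right.
  rewrite /= (_ : G0 `|` H = H) //.
  by apply/setUidr => x G0x; apply: KH; left.
have [Kfield Ktot Kfun Kinj] := goodK.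
set A := field K in Kfield Ktot.
have Aa i : A (a i) by exists (a (pickle (i, i))); apply: G0K; exists (i, i).
have [f Kf] : exists f : T -> T -> T, forall x y, A x -> A y -> K (x, y, f x y).
  have /choice[g Kg] : forall p : T * T, exists z, A p.1 -> A p.2 -> K (p, z).
    move=> [x y]; have [[Ax Ay]|nA] := pselect (A x /\ A y).
      by have [z Kz] := Ktot _ _ Ax Ay; exists z.
    by exists x => /= Ax Ay; case: nA.
  by exists (fun x y => g (x, y)) => x y Ax Ay; exact: (Kg (x, y)).
have Af x y : A x -> A y -> A (f x y).
  by move=> Ax Ay; have [] := Kfield _ _ _ (Kf _ _ Ax Ay).
have f_inj x y x' y' : A x -> A y -> A x' -> A y' ->
    f x y = f x' y' -> x = x' /\ y = y'.
  move=> Ax Ay Ax' Ay' ff; have := Kf _ _ Ax' Ay'; rewrite -ff => /Kinj.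
  by move=> /(_ _ (Kf _ _ Ax Ay))[].
have [/Card_le_injP[phi [phiA phi_inj]]|/Card_le_injP[phi [phiA phi_inj]]] :=
  card_num_le_total (Card A) (Card (~` A)); last first.
  (* Here the complement of [A] injects into [A]. The tags [a 0] and [a 1] keep the images of [A]
     and of its complement apart, so [h] embeds [T] in [A], and [f] then embeds the square. *)
  pose h x :=
    if pselect (A x) is left _ then f (a 0%N) x else f (a 1%N) (phi x).
  have Ah x : A (h x) by rewrite /h; case: pselect => [Ax|/phiA Ax]; exact: Af.
  have h_inj : injective h.
    move=> x y; rewrite /h.
    case: pselect => [Ax|nAx]; case: pselect => [Ay|nAy].
    - by move=> /f_inj[].
    - by move=> /f_inj[]//; [exact: phiA|move/a_inj].
    - by move=> /f_inj[]//; [exact: phiA|move/a_inj].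
    - by move=> /f_inj[]//; [exact: phiA|exact: phiA|move=> _; exact: phi_inj].
  apply/CardT_leP; exists (fun p => f (h p.1) (h p.2)) => -[x y] [x' y'] /=.
  by move=> /f_inj[]// /h_inj-> /h_inj->.
(* In the other case [A] has a disjoint copy in its complement: [d false] parametrizes [A] and
   [d true] the copy. The relation is extended to their union, against maximality. *)
pose d (b : bool) x := if b then phi x else x.
have d_inj b x b' x' : A x -> A x' -> d b x = d b' x' -> b = b' /\ x = x'.
  case: b; case: b' => //= Ax Ax'; first by move=> /phi_inj->.
    by move=> xx'; case: (phiA x Ax); rewrite xx'.
  by move=> xx'; case: (phiA x' Ax'); rewrite -xx'.
(* The quadrant with [b = b' = false] keeps the values of [f]. The other three are sent into the
   copy of [A], and the tag with index [b + 2 b'], one of 1, 2, 3, tells them apart. *)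
pose v (b b' : bool) x y :=
  if b || b' then f (a (b + b'.*2)%N) (f x y) else f x y.
have Av b b' x y : A x -> A y -> A (v b b' x y).
  move=> Ax Ay; rewrite /v; case: ifP => _; last exact: Af.
  by apply: (Af) => //; exact: Af.
pose H := [set t | exists b b' x y,
  [/\ A x, A y & t = (d b x, d b' y, d (b || b') (v b b' x y))]].
have fH b x : A x -> field H (d b x).
  by move=> Ax; exists (d (b || b) (v b b x x)), b, b, x, x.
have KH : K `<=` H.
  move=> [[x y] z] Kt; have [Ax Ay Az] := Kfield _ _ _ Kt.
  exists false, false, x, y; split=> //=.
  by rewrite (Kfun _ _ _ Kt (Kf _ _ Ax Ay)).
have fHE x : field H x -> exists b x', A x' /\ x = d b x'.
  by move=> [z [b [b' [x' [y' [Ax' Ay' [-> _ _]]]]]]]; exists b, x'.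
have goodH : good H.
  split.
  - move=> _ _ _ [b [b' [x [y [Ax Ay [-> -> ->]]]]]].
    by split; apply: fH => //; exact: Av.
  - move=> _ _ /fHE[b [x [Ax ->]]] /fHE[b' [y [Ay ->]]].
    by exists (d (b || b') (v b b' x y)), b, b', x, y.
  - move=> p z z' [b [b' [x [y [Ax Ay [-> ->]]]]]].
    move=> [c [c' [x' [y' [Ax' Ay' [+ + ->]]]]]].
    by move=> /d_inj[]// -> -> /d_inj[]// -> ->.
  - move=> p z z' [b [b' [x [y [Ax Ay [-> ->]]]]]].
    move=> [c [c' [x' [y' [Ax' Ay' [->]]]]]].
    move=> /d_inj[]; [exact: Av|exact: Av|].
    rewrite /v; case: ifP => bb' /esym cc'; rewrite cc'.
      move=> /f_inj[]//; [exact: Af|exact: Af|move=> /a_inj + /f_inj[]// -> ->].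
      by case: b b' c c' {bb' cc'} => -[] [] [].
    move=> /f_inj[]// -> ->.
    by case: b b' c c' bb' cc' => -[] [] [].
(* By maximality this new point would already lie in [A], whereas [phi] takes its values on [A] in
   the complement. *)
have [u /(maxK _ KH goodH) Ku] : field H (phi (a 0%N)) by exact: (fH true).
by case: (phiA _ (Aa 0%N)); exists u.
Qed.

End square.

(** * Absorption laws for infinite cardinals *)

Section infinite_cardinals.
Variable c : cardinal.
Hypothesis c_inf : aleph0 <= c.

Lemma card_num_mul_self : c * c = c.
Proof.
elim/card_ind: c c_inf => T /CardT_leP[a a_inj]; rewrite -CardT_mul.
apply: card_num_le_anti; first exact: CardT_square_infinite a_inj.
by apply/CardT_leP; exists (fun x => (x, x)) => x y [].
Qed.

Lemma card_num_mul_le (a b : cardinal) : a <= c -> b <= c -> a * b <= c.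
Proof. by move=> ac bc; rewrite -card_num_mul_self; exact: card_num_le_mul. Qed.

(** The sum [c + c] embeds in [c * c], two distinct elements of [c] marking the summands. *)
Lemma card_num_add_le (a b : cardinal) : a <= c -> b <= c -> a + b <= c.
Proof.
move=> ac bc; apply: (card_num_le_trans (card_num_le_add ac bc)).
rewrite -[X in _ <= X]card_num_mul_self.
elim/card_ind: c c_inf => T /CardT_leP[a' a_inj]; rewrite -CardT_mul -CardT_add.
apply/CardT_leP.
exists (fun p => match p with inl x => (a' 0%N, x) | inr x => (a' 1%N, x) end).
by move=> [x|x] [y|y] [] => [->//|/a_inj|/a_inj|->].
Qed.

End infinite_cardinals.

Lemma card_num_le_mull (a b : cardinal) : aleph0 <= b -> a <= a * b.
Proof.
elim/card_ind: a => a; elim/card_ind: b => b /CardT_leP[f _].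
rewrite -CardT_mul.
by apply/CardT_leP; exists (fun x => (x, f 0%N)) => x y [].
Qed.

(** The minimum defining [aleph1] is over a nonempty class: by Cantor's diagonal argument,
    [nat -> bool] is uncountable. *)
Lemma aleph0_lt_aleph1 : aleph0 < aleph1.
Proof.
suff /card_minP[] : exists c, aleph0 < c by [].
exists (CardT (nat -> bool)); apply/card_num_ltP => /CardT_leP[f f_inj].
pose D n := ~~ `[< exists g, f g = n /\ g n >].
have [Dn|/negP/negbNE/asboolP[g [/f_inj -> //]]] := pselect (D (f D)).
by move/negP: (Dn); apply; apply/asboolP; exists D.
Qed.

Lemma aleph0_le_CardP (T : Type) (A : set T) :
  infinite_set A <-> aleph0 <= Card A.
Proof.
rewrite infiniteP /card_num_le (card_le_eql (card_reprE _)).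
by rewrite (card_le_eqr (card_reprE _)) (card_le_eqr (CardT_sig A)).
Qed.

(** If the larger set is infinite, it absorbs the smaller one. Otherwise both sets are finite, and
    so is their union, which is then smaller than the infinite [k]. *)
Lemma small_subsetsU (X : Type) (k : cardinal) (A B : set X) : aleph0 <= k ->
  small_subsets k A -> small_subsets k B -> small_subsets k (A `|` B).
Proof.
move=> k_inf; wlog AB : A B / Card A <= Card B.
  have [AB|BA] := card_num_le_total (Card A) (Card B); first exact.
  by move=> + sA sB => /(_ B A BA sB sA); rewrite setUC.
rewrite /small_subsets /= => _ /card_num_ltP Bk; apply/card_num_ltP => kU.
apply: Bk.
have [B_inf|nB_inf] := pselect (aleph0 <= Card B).
  apply: (card_num_le_trans kU).
  apply: card_num_le_trans (card_num_add_le B_inf AB (card_num_le_refl _)).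
  rewrite -CardT_add; apply: (@Card_le_rel _ _ _ (fun x p =>
    match p with inl a => x = sval a | inr b => x = sval b end)).
    move=> x [Ax|Bx]; first by exists (inl (exist _ x Ax)).
    by exists (inr (exist _ x Bx)).
  by move=> x y [v|v] _ _ -> ->.
have fin (S : set X) : ~ aleph0 <= Card S -> finite_set S.
  by move=> nS; apply: contrapT => /aleph0_le_CardP.
have : infinite_set (A `|` B).
  by apply/aleph0_le_CardP; exact: card_num_le_trans kU.
case; rewrite finite_setU; split; last exact: fin.
by apply: fin => /card_num_le_trans /(_ AB).
Qed.

Lemma Card_bigcup_le (I T : Type) (D : I -> set T) (N : cardinal) :
  (forall i, Card (D i) <= N) -> Card (\bigcup_i D i) <= CardT I * N.
Proof.
elim/card_ind: N => V DV; rewrite -CardT_mul.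
pose f i := sval (cid ((CardT_leP _ _).1 (DV i))).
have f_inj i : injective (f i) := svalP (cid ((CardT_leP _ _).1 (DV i))).
apply: (@Card_le_rel _ _ _
  (fun x p => exists h : D p.1 x, f p.1 (exist _ x h) = p.2)).
  by move=> x [i _ Dx]; exists (i, f i (exist _ x Dx)); exists Dx.
by move=> x y [i v] _ _ /= [Dx <-] [Dy] /f_inj[].
Qed.

Lemma Card_range_le (I T : Type) (f : I -> T) : Card (range f) <= CardT I.
Proof.
apply: (@Card_le_rel _ _ _ (fun x i => f i = x)) => [x [i _ <-]|].
  by exists i.
by move=> x y i _ _ <- <-.
Qed.

Lemma Card_subset_le (T : Type) (A B : set T) : A `<=` B -> Card A <= Card B.
Proof. by move=> AB; apply/Card_leP; exact: subset_card_le. Qed.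

(** * Minima and suprema of cardinals of sets *)

Lemma Cards_minP (T : Type) (F : set (set T)) : F !=set0 ->
  exists2 A, F A & card_min (Cards F) = Card A.
Proof.
by move=> [A FA]; have [] : card_lower (Cards F) (card_min (Cards F));
  [apply: card_minP; exists (Card A), A|].
Qed.

Lemma Cards_min_le (T : Type) (F : set (set T)) (A : set T) : F A ->
  card_min (Cards F) <= Card A.
Proof.
move=> FA; have [_] : card_lower (Cards F) (card_min (Cards F)).
  by apply: card_minP; exists (Card A), A.
by apply; exists A.
Qed.

Lemma card_min_le (P : cardinal -> Prop) (c : cardinal) :
  P c -> card_min P <= c.
Proof. by move=> Pc; have [|_] := @card_minP P; [exists c|exact]. Qed.

Lemma Cards_sup_le (T : Type) (F : set (set T)) (c : cardinal) :
  (forall A, F A -> Card A <= c) -> card_sup (Cards F) <= c.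
Proof. by move=> Fc; apply: card_min_le => _ [A /Fc + ->]. Qed.

(** The cardinal of the whole type is an upper bound, so the supremum is a genuine minimum and not
    the junk value. *)
Lemma Cards_le_sup (T : Type) (F : set (set T)) (A : set T) : F A ->
  Card A <= card_sup (Cards F).
Proof.
move=> FA; rewrite /card_sup.
have [|+ _] := @card_minP (fun c => forall d, Cards F d -> d <= c).
  by exists (Card [set: T]) => _ [B _ ->]; exact: Card_subset_le.
by apply; exists A.
Qed.

(** ** Cardinal functions of arbitrary spaces *)

Section cardinal_inequalities.
Variable Y : topologicalType.

Lemma basis_ex (B : set (set Y)) (U : set Y) (y : Y) :
  basis B -> open U -> U y -> exists V, [/\ B V, V y & V `<=` U].
Proof.
move=> [_ By] oU Uy.
have [V [BV Vy] VU] := By y _ (open_nbhs_nbhs (conj oU Uy)).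
by exists V.
Qed.

Lemma weight_basis :
  exists2 B : set (set Y), basis B & weight Y = aleph0 + Card B.
Proof.
have [|B bB Bmin] := @Cards_minP _ [set B : set (set Y) | basis B].
  exists open; split=> // y U; rewrite nbhsE => -[V [oV Vy] VU].
  by exists V.
by exists B; rewrite // /weight Bmin.
Qed.

Lemma density_le_weight : density Y <= weight Y.
Proof.
have [B bB ->] := weight_basis.
pose B' := [set V | B V /\ V !=set0].
have /choice[f Vf] : forall V : {V | B' V}, exists y, sval V y.
  by move=> [V []].
apply: card_num_le_add; first exact: card_num_le_refl.
have /Cards_min_le minf : [set D : set Y | dense D] (range f).
  move=> O [y Oy] oO; have [V [BV Vy VO]] := basis_ex bB oO Oy.
  have B'V : B' V by split=> //; exists y.
  exists (f (exist _ V B'V)); split; last by exists (exist _ V B'V).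
  exact: VO (Vf (exist _ V B'V)).
apply: (card_num_le_trans minf); apply: (card_num_le_trans (Card_range_le f)).
by apply: Card_subset_le => V [].
Qed.

(** For each basic set contained in some member of the cover, one such member is chosen. The chosen
    members still cover. *)
Lemma lindelof_le_weight : lindelof_number Y <= weight Y.
Proof.
have [B bB ->] := weight_basis.
apply: card_num_le_add; first exact: card_num_le_refl.
apply: card_min_le => U [Uopen Ucover].
pose B' := [set V | B V /\ exists2 W, U W & V `<=` W].
have /choice[f Vf] : forall V : {V | B' V}, exists W, U W /\ sval V `<=` W.
  by move=> [V B'V] /=; have [_ [W UW VW]] := B'V; exists W.
have fU : range f `<=` U by move=> _ [V _ <-]; have [] := Vf V.
exists (range f); split=> //.
  split; first by move=> W /fU /Uopen.
  rewrite -subTset => y _.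
  have [W UW Wy] : (\bigcup_(V in U) V) y by rewrite Ucover.
  have [V [BV Vy VW]] := basis_ex bB (Uopen _ UW) Wy.
  have B'V : B' V by split=> //; exists W.
  exists (f (exist _ V B'V)); first by exists (exist _ V B'V).
  by have [_] := Vf (exist _ V B'V); apply.
apply: (card_num_le_trans (Card_range_le f)).
by apply: Card_subset_le => V [].
Qed.

Lemma lindelof_subcover (U : set (set Y)) : open_cover U ->
  exists V, [/\ V `<=` U, open_cover V & Card V <= lindelof_number Y].
Proof.
move=> Ucover.
have [|/(_ _ Ucover)[V [VU Vcover VL]] _] := @card_minP
    (fun k => forall U : set (set Y), open_cover U ->
      exists V, [/\ V `<=` U, open_cover V & Card V <= k]).
  exists (Card [set: set Y]) => W Wcover; exists W; split=> //.
  exact: Card_subset_le.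
exists V; split=> //; apply: (card_num_le_trans VL); exact: card_num_le_addr.
Qed.

(** Each point of a discrete set has a basic neighbourhood meeting the set in that point alone, and
    this neighbourhood determines the point. *)
Lemma spread_le_weight : spread Y <= weight Y.
Proof.
have [B bB ->] := weight_basis.
apply: card_num_le_add; first exact: card_num_le_refl.
apply: Cards_sup_le => D discD.
apply: (@Card_le_rel _ _ _ (fun x V => sval V x /\ sval V `&` D `<=` [set x])).
  move=> x Dx; have [W oW Wx] := discD [set SigSub (mem_set Dx)].
  have Wx' : W x.
    have : [set SigSub (mem_set Dx)] (SigSub (mem_set Dx)) by [].
    by rewrite -Wx.
  have [V [BV Vx VW]] := basis_ex bB oW Wx'.
  exists (exist _ V BV); split=> // y [/VW Wy Dy].
  have : [set SigSub (mem_set Dx)] (SigSub (mem_set Dy)) by rewrite -Wx.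
  by move=> /(congr1 val).
by move=> x y V Dx Dy [Vx VDx] [Vy _]; apply/esym/VDx.
Qed.

(** One point is chosen from each member of a cellular family. By disjointness each member contains
    only its own chosen point, so the chosen points form a discrete set as large as the family. *)
Lemma souslin_le_spread : souslin_number Y <= spread Y.
Proof.
apply: card_num_le_add; first exact: card_num_le_refl.
apply: Cards_sup_le => U [Uopen U0 Utriv].
have /choice[f Vf] : forall V : {V | U V}, exists y, sval V y.
  by move=> [V UV]; exact: U0.
have Uinj V W y : U V -> U W -> V y -> W y -> V = W.
  by move=> UV UW Vy Wy; apply: Utriv => //; exists y.
have f_uniq (y z : set_type (range f)) V :
    U V -> V (val y) -> V (val z) -> y = z.
  move=> UV Vy Vz.
  have [W _ Wy] := set_mem (valP y).
  have [W' _ W'z] := set_mem (valP z).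
  have WV : sval W = V.
    by apply: (Uinj _ _ (val y)) => //; [exact: svalP|rewrite -Wy].
  have W'V : sval W' = V.
    by apply: (Uinj _ _ (val z)) => //; [exact: svalP|rewrite -W'z].
  have WW' : W = W'.
    by apply: eq_sig_hprop; [move=> *; exact: Prop_irrelevance|rewrite WV].
  by apply: val_inj; rewrite /= -Wy -W'z WW'.
have discf : discrete_subset (range f).
  move=> E.
  (* An arbitrary set [E] of chosen points is the trace of the union of the members that meet it. *)
  exists (\bigcup_(V in [set V | U V /\ exists2 x, E x & V (val x)]) V).
    by apply: bigcup_open => V [/Uopen].
  apply/seteqP; split=> [y [V [UV [z Ez Vz]] Vy]|y Ey].
    by rewrite (f_uniq y z V).
  have [W _ Wy] := set_mem (valP y).
  have Wv : sval W (val y) by rewrite -Wy.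
  by exists (sval W) => //; split; [exact: svalP|exists y].
apply: card_num_le_trans (Cards_le_sup discf).
apply: (@Card_le_rel _ _ _ (fun V y => V (sval y))).
  move=> V UV; have fV : range f (f (exist _ V UV)) by exists (exist _ V UV).
  by exists (exist _ _ fV) => /=; exact: (Vf (exist _ V UV)).
by move=> V W y UV UW; exact: Uinj.
Qed.

End cardinal_inequalities.

(** ** The topology of [Ck R X k] *)

Section Ck_topology.
Variables (R : realType) (X : topologicalType).
Local Open Scope ring_scope.
Implicit Types (f g h : continuousType X R) (A : set X) (e : R).

(** With its converse [lt_uball], this replaces the extended supremum by a uniform real bound
    strictly below the radius. *)
Lemma uball_lt f g A e : uball f A e g ->
  exists2 s, s < e & forall x, A x -> `|f x - g x| <= s.
Proof.
rewrite /uball /=; set S := (X in ereal_sup X) => Se.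
have SA x : A x -> (`|f x - g x|%:E <= ereal_sup S)%E.
  by move=> Ax; apply: ereal_sup_ubound; exists x.
case ES : (ereal_sup S) Se SA => [s| |] // Se SA.
  by exists s => // x /SA; rewrite lee_fin.
(* The supremum is [-oo], so [A] is empty and any real below [e] is a bound. *)
by exists (e - 1) => [|x /SA//]; rewrite gtrBl.
Qed.

Lemma lt_uball f g A e s : s < e -> (forall x, A x -> `|f x - g x| <= s) ->
  uball f A e g.
Proof.
move=> se fg; apply: (@le_lt_trans _ _ s%:E); last by rewrite lte_fin.
by apply: ge_ereal_sup => _ [x Ax <-]; rewrite lee_fin; exact: fg.
Qed.

Lemma uballxx f A e : 0 < e -> uball f A e f.
Proof. by move=> e0; apply: (lt_uball e0) => x _; rewrite subrr normr0. Qed.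

Lemma uballC f g A e : uball f A e g -> uball g A e f.
Proof.
by move=> /uball_lt[s se fg]; apply: (lt_uball se) => x Ax;
  rewrite distrC; exact: fg.
Qed.

Lemma uball_trans f g h A e1 e2 :
  uball f A e1 g -> uball g A e2 h -> uball f A (e1 + e2) h.
Proof.
move=> /uball_lt[s se fg] /uball_lt[t te gh].
apply: (@lt_uball _ _ _ _ (s + t)); first exact: ltrD.
move=> x Ax; apply: (le_trans (ler_distD (g x) _ _)).
by apply: lerD; [exact: fg|exact: gh].
Qed.

Lemma uball_le f A B e e' : A `<=` B -> e' <= e ->
  uball f B e' `<=` uball f A e.
Proof.
move=> AB ee g /uball_lt[s se fg]; apply: (@lt_uball _ _ _ _ s).
  exact: lt_le_trans ee.
by move=> x /AB; exact: fg.
Qed.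

(** The set where the distance of [f] and [g] is at most [s] is closed, so a bound on [B] persists
    on its closure. This lets members of a closed family stand in for all small sets. *)
Lemma uball_closure f A B e e' : A `<=` closure B -> e' < e ->
  uball f B e' `<=` uball f A e.
Proof.
move=> AB ee g /uball_lt[s se fg]; apply: (@lt_uball _ _ _ _ s).
  exact: lt_trans ee.
move=> x /AB Bx.
have cfg : continuous (fun x => `|f x - g x| : R^o).
  move=> y; apply: (@continuous_comp _ _ _ (fun x => f x - g x : R^o)
    (@Num.norm _ R^o)); last exact: norm_continuous.
  by apply: (@continuousB _ R^o _ f g); exact: cts_fun.
have cls : closed [set x | `|f x - g x| <= s].
  apply: (@closed_comp _ _ (fun x => `|f x - g x| : R^o) [set y : R | y <= s]).
    by [].
  exact: closed_le.
have BS : B `<=` [set x | `|f x - g x| <= s] by move=> y; exact: fg.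
by have := closureS BS Bx; rewrite -(closure_id _).1.
Qed.

Variable k : cardinal.

Lemma uball_open f A e : small_subsets k A -> 0 < e ->
  open (uball f A e : set (Ck R X k)).
Proof.
move=> sA e0; exists [set uball f A e]; last by rewrite bigcup_set1.
move=> _ ->; by apply: finI_from1; exists f, A, e.
Qed.

Hypothesis k_inf : (aleph0 <= k)%card_num.

Lemma small_subsets0 : @small_subsets X k set0.
Proof.
apply/card_num_ltP => /(card_num_le_trans k_inf).
by move=> /CardT_leP[i _]; case: (i 0%N).
Qed.

(** An open set is a union of finite intersections of balls. Each ball around [f] in such an
    intersection is recentred at [f] by the triangle inequality; finitely many are then merged by
    taking the union of the sets and the least radius. *)
Lemma Ck_open_uball (U : set (Ck R X k)) f : open U -> U f ->
  exists A e, [/\ small_subsets k A, 0 < e & uball f A e `<=` U].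
Proof.
move=> oU Uf.
have [D Dfin DU] : exists2 D : set (set (continuousType X R)),
    D `<=` finI_from (@uballs R X k) id & \bigcup_(V in D) V = U by exact: oU.
move: Uf; rewrite -DU => -[V DV Vf]; have [F Fsub VE] := Dfin _ DV.
suff [A [e [sA e0 AeV]]] : exists A e,
    [/\ small_subsets k A, 0 < e & uball f A e `<=` V].
  by exists A, e; split=> // g /AeV; exists V.
have FW : forall W, W \in finmap.enum_fset F -> exists A e,
    [/\ small_subsets k A, 0 < e & uball f A e `<=` W].
  move=> W WF; have /set_mem[g [A [e [sA e0 WE]]]] := Fsub _ WF.
  have : W f by move: Vf; rewrite -VE; exact.
  rewrite WE => /uball_lt[s se gf].
  exists A, (e - s); split=> //; first by rewrite subr_gt0.
  move=> h /uball_lt[t te fh]; apply: (@lt_uball _ _ _ _ (s + t)).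
    by rewrite addrC -ltrBrDr.
  move=> x Ax; apply: (le_trans (ler_distD (f x) _ _)).
  by apply: lerD; [exact: gf|exact: fh].
rewrite -VE.
suff capE (s : seq (set (continuousType X R))) :
    (forall W, W \in s -> exists A e,
      [/\ small_subsets k A, 0 < e & uball f A e `<=` W]) ->
    exists A e, [/\ small_subsets k A, 0 < e &
      uball f A e `<=` \bigcap_(i in [set i | i \in s]) i].
  exact: (capE (finmap.enum_fset F)).
elim: s => [_|W s IH sW].
  exists set0, 1; split=> //; exact: small_subsets0.
have [|A [e [sA e0 AeW]]] := IH.
  by move=> W' W's; apply: sW; rewrite inE W's orbT.
have [B [e' [sB e'0 BeW]]] := sW W (mem_head _ _).
exists (A `|` B), (Num.min e e'); split.
- exact: small_subsetsU.
- by rewrite lt_min e0.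
- move=> g ABg W'; rewrite /= inE => /orP[/eqP->|W's].
    apply: BeW; apply: uball_le ABg; last by rewrite ge_min lexx orbT.
    by move=> x; right.
  apply: AeW => //; apply: uball_le ABg; last by rewrite ge_min lexx.
  by move=> x; left.
Qed.

End Ck_topology.

(** * Cardinal functions of the function space *)

Section Ck_cardinals.
Variables (R : realType) (X : topologicalType) (k : cardinal).
Hypothesis k_inf : aleph0 <= k.
Local Notation Y := (Ck R X k).

Lemma cc_closed_family :
  exists2 F : set (set X), closed_family k F & cc X k = aleph0 + Card F.
Proof.
have [|F cF Fmin] := @Cards_minP _ [set F : set (set X) | closed_family k F].
  exists (small_subsets k); split=> // A sA.
  by exists A => //; exact: subset_closure.
by exists F; rewrite // /cc Fmin.
Qed.

(** A base is formed by the balls with centre in a dense set, radius [1 / (n + 1)] and underlying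
    set in a closed family. *)
Lemma weight_le_cc_density : weight Y <= cc X k * density Y.
Proof.
have [F [Fsmall Fclosed] ->] := cc_closed_family.
have [|D dD Dmin] := @Cards_minP _ [set D : set Y | dense D].
  by exists setT => V [x Vx] _; exists x.
rewrite /density Dmin; set a := aleph0 + Card F; set d := aleph0 + Card D.
have a_inf : aleph0 <= a by exact: card_num_le_addl.
have ad_inf : aleph0 <= a * d.
  apply: (card_num_le_trans a_inf); apply: card_num_le_mull.
  exact: card_num_le_addl.
apply: card_num_add_le => //.
pose ball (p : {A | F A} * nat * {f | D f}) : set Y :=
  uball (sval p.2) (sval p.1.1) p.1.2.+1%:R^-1%R.
have /Cards_min_le minB : [set B : set (set Y) | basis B] (range ball).
  split=> [_ [[[A n] f] _ <-]|f U].
    by apply: uball_open; [exact/Fsmall/svalP|rewrite invr_gt0 ltr0n].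
  rewrite nbhsE => -[V [oV Vf] VU].
  have [A [e [sA e0 AeV]]] := Ck_open_uball k_inf oV Vf.
  have [B FB AB] := Fclosed _ sA.
  (* Half of [e], because passing from [f] to the nearby centre [g] and on to a point of the ball
     around [g] uses the radius twice. *)
  have [n n_e] : exists n : nat, (n.+1%:R^-1 < e / 2)%R.
    have [n] := ltr_add_invr (divr_gt0 e0 (ltr0Sn R 1)).
    by rewrite add0r; exists n.
  have n0 : (0 < n.+1%:R^-1 :> R)%R by rewrite invr_gt0 ltr0n.
  have [|g [fg Dg]] := dD _ _ (uball_open f (Fsmall _ FB) n0).
    by exists f; exact: uballxx.
  exists (ball ((exist _ B FB, n), exist _ g Dg)).
    by split; [exists ((exist _ B FB, n), exist _ g Dg)|exact: uballC].
  move=> h /(uball_trans fg) fh; apply/VU/AeV.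
  by apply: uball_closure fh => //; rewrite [ltRHS]splitr ltrD.
apply: (card_num_le_trans minB).
apply: (card_num_le_trans (Card_range_le ball)).
rewrite !CardT_mul; apply: card_num_le_mul; last exact: card_num_le_addr.
by apply: card_num_mul_le => //; exact: card_num_le_addr.
Qed.

(** A bound on how many translates of a basic neighbourhood cover the group
    [Ck R X k] ([N]-narrowness). *)
Definition narrow (N : cardinal) := forall (A : set X) (e : R),
  small_subsets k A -> (0 < e)%R ->
  exists2 D : set Y, Card D <= N & forall f, exists2 d, D d & uball d A e f.

Lemma density_le_cc_narrow (N : cardinal) : aleph0 <= N -> narrow N ->
  density Y <= cc X k * N.
Proof.
move=> N_inf Nnarrow; have [F [Fsmall Fclosed] ->] := cc_closed_family.
set a := aleph0 + Card F; have a_inf : aleph0 <= a by exact: card_num_le_addl.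
have aN_inf : aleph0 <= a * N.
  by apply: (card_num_le_trans a_inf); exact: card_num_le_mull.
apply: card_num_add_le => //.
(* For each member of the closed family and each radius, [D p] is a net of at most [N] centres. The
   union of these nets is dense. *)
have /choice[D ND] : forall p : {A | F A} * nat, exists D : set Y,
    Card D <= N /\
    forall f, exists2 d, D d & uball d (sval p.1) p.2.+1%:R^-1%R f.
  move=> [A n]; have [||D ND Dnet] := Nnarrow (sval A) n.+1%:R^-1%R.
  - exact/Fsmall/svalP.
  - by rewrite invr_gt0 ltr0n.
  - by exists D.
have /Cards_min_le minD : [set D : set Y | dense D] (\bigcup_p D p).
  move=> V [f Vf] oV; have [A [e [sA e0 AeV]]] := Ck_open_uball k_inf oV Vf.
  have [B FB AB] := Fclosed _ sA.
  have [n n_e] : exists n : nat, (n.+1%:R^-1 < e)%R.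
    by have [n] := ltr_add_invr e0; rewrite add0r; exists n.
  have [_ /(_ f)[d Dd df]] := ND (exist _ B FB, n).
  exists d; split; last by exists (exist _ B FB, n).
  by apply: AeV; apply: (uball_closure AB n_e); exact: uballC.
apply: (card_num_le_trans minD).
have DN p : Card (D p) <= N by have [] := ND p.
apply: (card_num_le_trans (Card_bigcup_le DN)).
apply: card_num_le_mul; last exact: card_num_le_refl.
by rewrite CardT_mul; apply: card_num_mul_le => //; exact: card_num_le_addr.
Qed.

Lemma narrow_lindelof : narrow (lindelof_number Y).
Proof.
move=> A e sA e0.
have Ucover : open_cover [set (uball f A e : set Y) | f in [set: Y]].
  split=> [_ [f _ <-]|]; first exact: uball_open.
  rewrite -subTset => f _; exists (uball f A e); first by exists f.
  exact: uballxx.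
have [V [VU [_ Vcover] VL]] := lindelof_subcover Ucover.
have /choice[c Vc] : forall W : {W | V W}, exists f : Y, sval W = uball f A e.
  by move=> [W VW]; have [f _ fW] := VU _ VW; exists f.
exists (range c); first exact: card_num_le_trans (Card_range_le c) VL.
move=> f; have [W VW Wf] : (\bigcup_(W in V) W) f by rewrite Vcover.
exists (c (exist _ W VW)); first by exists (exist _ W VW).
by rewrite -Vc.
Qed.

Lemma narrow_souslin : narrow (souslin_number Y).
Proof.
move=> A e sA e0; have e2 : (0 < e / 2)%R by rewrite divr_gt0.
(* The half-radius balls around the points of [D] are disjoint. For a maximal such [D], the
   half-radius ball of any [f] meets one of them, so [f] is within [e] of its centre. *)
pose sep := [set D : set Y | forall f g h, D f -> D g ->
  uball f A (e / 2)%R h -> uball g A (e / 2)%R h -> f = g].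
have [|D [sepD maxD]] := @Zorn_bigcup _ sep.
  move=> C Csep Ctot f g h [D CD Df] [E CE Eg].
  have [DE|ED] := Ctot _ _ CD CE.
    by apply: (Csep _ CE) => //; exact: DE.
  by apply: (Csep _ CD) => //; exact: ED.
exists D.
  have cellD : cellular_family [set (uball f A (e / 2)%R : set Y) | f in D].
    split=> [_ [f _ <-]|_ [f _ <-]|_ _ [f Df <-] [g Dg <-] [h [fh gh]]].
    - exact: uball_open.
    - by exists f; exact: uballxx.
    - by rewrite (sepD _ _ _ Df Dg fh gh).
  have /= cD := Cards_le_sup cellD.
  apply: card_num_le_trans (card_num_le_addr _ _).
  apply: card_num_le_trans cD.
  (* Distinct centres have distinct balls, since each ball contains its centre and the balls are
     disjoint. *)
  apply: (@Card_le_inj _ _ (fun f => uball f A (e / 2)%R : set Y)).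
    by move=> f Df; exists f.
  move=> f g Df Dg fg; apply: (sepD _ _ f Df Dg); first exact: uballxx.
  by rewrite -fg; exact: uballxx.
move=> f; apply: contrapT => nf.
have fD g h : D g -> uball g A (e / 2)%R h -> ~ uball f A (e / 2)%R h.
  move=> Dg gh fh; apply: nf; exists g => //.
  by rewrite [e]splitr; apply: uball_trans gh _; exact: uballC.
apply: (maxD (D `|` [set f])).
  split=> [g Dg|/(_ f)Df]; first by left.
  by apply: nf; exists f; [apply: Df; right|exact: uballxx].
move=> g g' h [Dg|->] [Dg'|->] // gh g'h; first exact: sepD gh g'h.
  by case: (fD _ _ Dg gh).
by case: (fD _ _ Dg' g'h).
Qed.

Lemma cc_le_weight : completely_regular_space X -> cc X k <= weight Y.
Proof.
move=> crX; have [B bB ->] := weight_basis Y.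
apply: card_num_le_add; first exact: card_num_le_refl.
pose one : continuousType X R := cst 1%R.
pose B' := [set V : set Y | B V /\ V one].
have /choice[S VS] : forall V : {V | B' V}, exists A : set X,
    small_subsets k A /\ exists2 e, (0 < e)%R & uball one A e `<=` sval V.
  move=> [V B'V] /=; have [BV Vone] := B'V.
  have [A [e [sA e0 AeV]]] := Ck_open_uball k_inf (bB.1 _ BV) Vone.
  by exists A; split=> //; exists e.
have /Cards_min_le minS : [set F : set (set X) | closed_family k F] (range S).
  split=> [_ [V _ <-]|A sA]; first by have [] := VS V.
  (* The set chosen for a basic [V] inside the ball of radius 1 over [A] has [A] in its closure. *)
  have [V [BV Vone VA]] := basis_ex bB
    (uball_open one sA ltr01 : open (uball one A 1%R : set Y))
    (uballxx _ _ ltr01).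
  have B'V : B' V by [].
  exists (S (exist _ V B'V)); first by exists (exist _ V B'V).
  have [_ [e e0 SeV]] := VS (exist _ V B'V).
  move=> x Ax; apply: contrapT => nSx.
  have /(@uniform_separatorP _ R)[h [ch _ hx hS]] :=
    crX x _ (@closed_closure _ _) nSx.
  pose h' : continuousType X R := HB.pack h (isContinuous.Build _ _ h ch).
  (* The separating function is 1 on the closure of the chosen set, hence lies in [V]. At [x] it is
     0, at distance 1 from [one], which the ball of radius 1 over [A] forbids. *)
  have /SeV /VA /uball_lt[s s1 /(_ _ Ax)] : uball one (S (exist _ V B'V)) e h'.
    apply: (lt_uball e0) => y Sy; rewrite /= (_ : h y = 1%R) ?subrr ?normr0 //.
    by apply: hS; exists y => //; exact: subset_closure.
  rewrite /= (_ : h x = 0%R); last by apply: hx; exists x.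
  by rewrite subr0 normr1 leNgt s1.
apply: (card_num_le_trans minS); apply: (card_num_le_trans (Card_range_le S)).
by apply: Card_subset_le => V [].
Qed.

End Ck_cardinals.

(** * Equality of the weight with the four products *)

Theorem theorem5p33 (R : realType) (X : topologicalType) (k : cardinal)
    (hX : tychonoff_space X) (hk : aleph1 <= k) :
  [/\ weight (Ck R X k) = cc X k * density (Ck R X k),
      cc X k * density (Ck R X k) = cc X k * lindelof_number (Ck R X k),
      cc X k * lindelof_number (Ck R X k) = cc X k * spread (Ck R X k)
    & cc X k * spread (Ck R X k) = cc X k * souslin_number (Ck R X k)].
Proof.
have k_inf : aleph0 <= k.
  by apply: card_num_le_trans hk; exact: aleph0_lt_aleph1.1.
have w_inf : aleph0 <= weight (Ck R X k) by exact: card_num_le_addl.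
have cc_inf : aleph0 <= cc X k by exact: card_num_le_addl.
have cc_w : cc X k <= weight (Ck R X k) by exact: cc_le_weight hX.1.
have w_d := @weight_le_cc_density R X k k_inf.
have upper N : N <= weight (Ck R X k) -> weight (Ck R X k) <= cc X k * N ->
    cc X k * N = weight (Ck R X k).
  by move=> Nw wN; apply: card_num_le_anti => //; exact: card_num_mul_le.
(* The weight is at most [cc * d], and [d] is at most [cc * N]; the infinite product [cc * N]
   absorbs the extra factor [cc]. *)
have narrow_weight N : aleph0 <= N -> narrow R X k N ->
    weight (Ck R X k) <= cc X k * N.
  move=> N_inf Nnarrow; apply: (card_num_le_trans w_d).
  have ccN_inf := card_num_le_trans cc_inf (card_num_le_mull (cc X k) N_inf).
  apply: card_num_mul_le => //; first exact: card_num_le_mull.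
  exact: density_le_cc_narrow.
have s_w := spread_le_weight (Ck R X k).
have c_s := souslin_le_spread (Ck R X k).
have w_c : weight (Ck R X k) <= cc X k * souslin_number (Ck R X k).
  by apply: narrow_weight; [exact: card_num_le_addl|exact: narrow_souslin].
have dE := upper _ (density_le_weight _) w_d.
have LE : cc X k * lindelof_number (Ck R X k) = weight (Ck R X k).
  apply: upper; first exact: lindelof_le_weight.
  by apply: narrow_weight; [exact: card_num_le_addl|exact: narrow_lindelof].
(* The spread lies between the Souslin number and the weight, so the lower bound is inherited from
   [w_c]. *)
have sE : cc X k * spread (Ck R X k) = weight (Ck R X k).
  apply: upper => //; apply: (card_num_le_trans w_c).
  by apply: card_num_le_mul => //; exact: card_num_le_refl.
have cE := upper _ (card_num_le_trans c_s s_w) w_c.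
by rewrite dE LE sE cE.
Qed.
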